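(* For all positive integers $m,n$ and every positive divisor $E$ of $\operatorname{lcm}(m,n)$ we have $$s_E(m,n)=\sum_{\substack{i\mid m,\ j\mid n\\ \operatorname{lcm}(i,j)=E}}\gcd(i,j)=\frac1{E}\sum_{\substack{i\mid m,\ j\mid n\\ \operatorname{lcm}(i,j)=E}} ij.$$
   Context: $\mathbb{Z}_n$ denotes the cyclic group of order $n$. $s_E(m,n)$ denotes the number of subgroups of exponent (exactly) $E$ of the group $\mathbb{Z}_m\times\mathbb{Z}_n$. Sums over divisors run over positive divisors. *)

(* Defs.v *)
From mathcomp Require Import all_boot all_order all_algebra all_fingroup all_solvable.

Set Implicit Arguments.
Unset Strict Implicit.
Unset Printing Implicit Defensive.

Local Open Scope nat_scope.

(* [Zp n], rather than the whole type ['Z_n], is the cyclic group of order n: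
   ['Z_1] has two elements, but [Zp 1] is trivial.  For n > 1, [Zp n] is all
   of ['Z_n]. *)
Definition Zp_prod (m n : nat) : {group 'Z_m * 'Z_n} :=
  setX_group [group of Zp m] [group of Zp n].

Lemma card_Zp_prod (m n : nat) :
  0 < m -> 0 < n -> #|Zp_prod m n| = m * n.
Proof. by move=> m0 n0; rewrite cardsX !card_Zp. Qed.

Definition num_subgroups_exponent (E m n : nat) : nat :=
  #|[set H in subgroups (Zp_prod m n) | exponent H == E]|.

(* Main.v *)
Require Import Defs.
From mathcomp Require Import all_boot all_order all_algebra all_fingroup all_solvable.

Set Implicit Arguments.
Unset Strict Implicit.
Unset Printing Implicit Defensive.


(** A subgroup H of a product of cyclic groups G and K has projections A and B
    on the factors, and exponent H = lcm(|A|, |B|): the exponent of H is divided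
    by those of its images A and B, which are cyclic, while H is contained in
    A x B ([exponent_subgroup_prod]).  A cyclic group has exactly one subgroup
    of each order dividing its own, so the subgroups of exponent E are sorted by
    the pairs (i, j) = (|A|, |B|) with i %| |G|, j %| |K| and lcm(i, j) = E, and
    everything reduces to counting, for fixed cyclic A and B, the subgroups of
    A x B that project onto both A and B ([card_subdirect]): there are
    gcd(|A|, |B|) of them.

    Goursat's lemma would give this number as the sum over c dividing
    gcd(|A|, |B|) of the number totient(c) of isomorphisms between the quotients
    of order c of A and of B.  A single bijection avoids the sum.  Write
    A = <[x]>, and let z range over the elements of B whose order divides |A|;
    there are gcd(|A|, |B|) such z, which are the images of x under the
    homomorphisms from A to B.  To z corresponds the subgroup
      H_z = { (x^i, t) | t in B, t^(|B| / #[z]) = z^i }.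
    The exponent |B| / #[z] makes the powers of the elements of B fill exactly
    <[z]>, so that H_z projects onto A and onto B ([twisted_group_subdirect]).
    Conversely, if H projects onto A and B and (x, y) is in H, then H is H_z for
    z = y^d, where d is the order of { t | (1, t) in H }
    ([subdirect_twisted_group]); and H_z determines z ([twisted_group_inj]).

    The second equality holds term by term, as lcm(i, j) gcd(i, j) = ij. *)

Local Open Scope group_scope.

(** * Cyclic groups and powers in a product *)

Lemma expg_pair (gT rT : finGroupType) (s : gT) (t : rT) (k : nat) :
  (s, t) ^+ k = (s ^+ k, t ^+ k).
Proof. by elim: k => // k IHk; rewrite !expgS IHk. Qed.

Lemma mem_sub_cyclic (gT : finGroupType) (G H : {group gT}) (t : gT) :
  cyclic G -> H \subset G -> t \in G -> (t \in H) = (t ^+ #|H| == 1).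
Proof.
move=> cycG sHG Gt; rewrite -order_dvdn -cycle_subG.
by rewrite -(cardSg_cyclic cycG) ?cycle_subG.
Qed.

Lemma ex_sub_cyclic (gT : finGroupType) (G : {group gT}) (d : nat) :
  cyclic G -> d %| #|G| -> exists2 H : {group gT}, H \subset G & #|H| = d.
Proof.
case/cyclicP=> y -> d_dv; exists <[y ^+ (#[y] %/ d)]>%G; first exact: cycleX.
rewrite -[LHS]orderE orderXdiv; first by rewrite divnA // mulKn ?order_gt0.
by rewrite dvdn_div.
Qed.

(** The elements counted form the subgroup of G of order gcd(a, |G|). *)
Lemma card_order_dvd (gT : finGroupType) (G : {group gT}) (a : nat) :
  cyclic G -> #|[set z in G | #[z] %| a]| = gcdn a #|G|.
Proof.
move=> cycG; have [H sHG oH] := ex_sub_cyclic cycG (dvdn_gcdr a #|G|).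
rewrite -oH; apply: eq_card => z; rewrite inE.
have [Gz|nGz] /= := boolP (z \in G); last by rewrite (contraNF (subsetP sHG z)).
by rewrite (mem_sub_cyclic cycG) // oH -order_dvdn dvdn_gcd order_dvdG // andbT.
Qed.

(** * The subdirect subgroup attached to an element *)

(** When #[z] divides #[x], there is a homomorphism theta from <[x]> to <[z]>
    that sends x to z, and this is the equalizer of theta o fst and of the power
    map t |-> t^(|B| / #[z]) on <[x]> x B.  The existential over the exponents
    of x stands for theta, so that no proof of divisibility is carried. *)
Definition twisted_kernel (gT rT : finGroupType) (x : gT) (B : {set rT}) (z : rT)
    : {set gT * rT} :=
  [set p : gT * rT | (p.2 \in B) &&
    [exists i : 'I_#[x], (p.1 == x ^+ i) && (p.2 ^+ (#|B| %/ #[z]) == z ^+ i)]].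

(** The divisibility makes z ^+ i depend on x ^+ i only; hence any
    exponent i can be used, not just the representatives below #[x]. *)
Lemma twisted_kernelE (gT rT : finGroupType) (x : gT) (B : {group rT}) (z t : rT) i :
    #[z] %| #[x] ->
  ((x ^+ i, t) \in twisted_kernel x B z) =
    (t \in B) && (t ^+ (#|B| %/ #[z]) == z ^+ i).
Proof.
move=> dv; rewrite inE /=; congr (_ && _).
apply/existsP/idP=> [[j /andP[eqx /eqP ->]]|/eqP tz].
  rewrite eq_expg_mod_order in eqx.
  by rewrite eq_expg_mod_order eq_sym; have/eqP := eqx => /(congr1 (modn^~ #[z]));
     rewrite !modn_dvdm // => ->.
have lt_i: i %% #[x] < #[x] by rewrite ltn_mod order_gt0.
exists (Ordinal lt_i); rewrite /= expg_mod_order eqxx /= tz eq_expg_mod_order.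
by rewrite modn_dvdm.
Qed.

Lemma twisted_kernelP (gT rT : finGroupType) (x : gT) (B : {group rT}) (z : rT) p :
    #[z] %| #[x] ->
  reflect (exists i t, [/\ p = (x ^+ i, t), t \in B & t ^+ (#|B| %/ #[z]) = z ^+ i])
    (p \in twisted_kernel x B z).
Proof.
move=> dv; apply: (iffP idP) => [|[i [t [-> Bt /eqP tz]]]]; last first.
  by rewrite twisted_kernelE // Bt.
case: p => s t; rewrite inE /= => /andP[Bt /existsP[i /andP[/eqP-> /eqP tz]]].
by exists i, t.
Qed.

Lemma twisted_kernel_group_set (gT rT : finGroupType) (x : gT) (B : {group rT}) (z : rT) :
  cyclic B -> #[z] %| #[x] -> group_set (twisted_kernel x B z).
Proof.
move=> cycB dv; apply/group_setP; split.
  by rewrite -[1]/(x ^+ 0, 1) twisted_kernelE // group1 expg1n /=.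
move=> p q /(twisted_kernelP _ _ dv)[i [t [-> Bt tz]]].
case/(twisted_kernelP _ _ dv)=> [j [u [-> Bu uz]]].
rewrite -[_ * _]/(x ^+ i * x ^+ j, t * u) -expgD twisted_kernelE // groupM //=.
rewrite expgMn ?tz ?uz ?expgD //.
exact: (centsP (cyclic_abelian cycB)).
Qed.

(** Taking the generated subgroup provides a group structure for every z, so that
    z |-> twisted_group x B z is a total function; when z has order dividing #[x],
    generation adds nothing ([twisted_groupE]). *)
Definition twisted_group (gT rT : finGroupType) (x : gT) (B : {set rT}) (z : rT)
  : {group gT * rT} := <<twisted_kernel x B z>>%G.

Lemma twisted_groupE (gT rT : finGroupType) (x : gT) (B : {group rT}) (z : rT) :
  cyclic B -> #[z] %| #[x] -> twisted_group x B z = twisted_kernel x B z :> {set _}.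
Proof.
by move=> cycB dv; rewrite /= gen_set_id ?twisted_kernel_group_set.
Qed.

(** Both groups are the subgroup of B of order #[z]: the power map by
    |B| / #[z] sends B onto <[z]>. *)
Lemma cycle_root (rT : finGroupType) (B : {group rT}) (y z : rT) :
    <[y]> = B -> z \in B -> <[y ^+ (#|B| %/ #[z])]> = <[z]>.
Proof.
move=> defB Bz; have cycB : cyclic B by rewrite -defB cycle_cyclic.
have By: y \in B by rewrite -defB cycle_id.
apply/eqP; rewrite (eq_subG_cyclic cycB) ?cycle_subG ?groupX //.
have dv : #[z] %| #|B| by apply: order_dvdG.
have oy : #[y] = #|B| by rewrite -defB.
rewrite -!orderE orderXdiv oy ?dvdn_div // divnA // mulKn //.
Qed.

(** * Counting subdirect subgroups of two cyclic groups *)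

Definition subdirect (gT rT : finGroupType) (A : {set gT}) (B : {set rT})
    (H : {set gT * rT}) : bool :=
  (fst @: H == A) && (snd @: H == B).

(** Both surjectivities come from [cycle_root]: every power of z is the
    (|B| / #[z])-th power of some t in B, and every such power is a power of z. *)
Lemma twisted_group_subdirect (gT rT : finGroupType) (x : gT) (B : {group rT}) (z : rT) :
    cyclic B -> z \in B -> #[z] %| #[x] ->
  subdirect <[x]> B (twisted_group x B z).
Proof.
move=> cycB Bz dv; have [y defB] := cyclicP cycB.
have By: y \in B by rewrite defB cycle_id.
have eqz := cycle_root (esym defB) Bz.
rewrite /subdirect twisted_groupE //; apply/andP; split; apply/eqP/setP=> s.
  apply/imsetP/idP=> [[p /(twisted_kernelP _ _ dv)[i [t [-> _ _]]] ->]|].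
    exact: mem_cycle.
  case/cycleP=> i ->.
  have /cycleP[k zk] : z \in <[y ^+ (#|B| %/ #[z])]> by rewrite eqz cycle_id.
  exists (x ^+ i, y ^+ (k * i)) => //; rewrite twisted_kernelE // groupX //=.
  by rewrite [in X in _ == X]zk -!expgM mulnC mulnA.
apply/imsetP/idP=> [[p /(twisted_kernelP _ _ dv)[i [t [-> Bt _]]] ->] //|Bs].
have /cycleP[l sl] : s \in <[y]> by rewrite -defB.
have /cycleP[i zi] : y ^+ (#|B| %/ #[z]) \in <[z]> by rewrite -eqz cycle_id.
exists (x ^+ (i * l), s) => //; rewrite twisted_kernelE // Bs /= sl.
by rewrite -expgM mulnC expgM zi -expgM.
Qed.

(** The fibre of the subgroup over 1 is the set of t in B killed by |B| / #[z], so
    it determines #[z]; then z is recovered as t^(|B| / #[z]) for any t in the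
    fibre over x. *)
Lemma twisted_group_inj (gT rT : finGroupType) (x : gT) (B : {group rT}) :
  cyclic B -> {in [set z in B | #[z] %| #[x]] &, injective (twisted_group x B)}.
Proof.
move=> cycB z z'; rewrite !inE => /andP[Bz dvz] /andP[Bz' dvz'] eqH.
have [y defB] := cyclicP cycB.
have By: y \in B by rewrite defB cycle_id.
have {eqH} eqK : twisted_kernel x B z = twisted_kernel x B z'.
  by rewrite -!twisted_groupE // eqH.
(* The element y^#[u] of the fibre over 1 for u must be killed by |B| / #[v]. *)
have order_dv (u v : rT) : u \in B -> v \in B -> #[u] %| #[x] -> #[v] %| #[x] ->
    twisted_kernel x B u = twisted_kernel x B v -> #[v] %| #[u].
  move=> Bu Bv du dv eqK'.
  have : (x ^+ 0, y ^+ #[u]) \in twisted_kernel x B v.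
    rewrite -eqK' twisted_kernelE // groupX //= -expgM mulnC divnK ?order_dvdG //.
    by rewrite defB expg_order.
  rewrite twisted_kernelE // => /andP[_]; rewrite -expgM -order_dvdn.
  have -> : #[y] = #|B| by rewrite defB.
  have Bgt0 := cardG_gt0 B; have dvB := order_dvdG Bv.
  by rewrite -{1}(divnK dvB) mulnC dvdn_pmul2r // divn_gt0 // dvdn_leq.
have eqo : #[z] = #[z'].
  by apply/eqP; rewrite eqn_dvd !order_dv.
have : x \in fst @: twisted_group x B z.
  by have /andP[/eqP-> _] := twisted_group_subdirect cycB Bz dvz; rewrite cycle_id.
rewrite twisted_groupE // => /imsetP[[s t] Kt /= eqx]; rewrite -{}eqx in Kt.
have Kt' := Kt; rewrite eqK -(expg1 x) twisted_kernelE // in Kt'.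
rewrite -(expg1 x) twisted_kernelE // in Kt.
case/andP: Kt Kt' => _ /eqP tz /andP[_ /eqP tz'].
by rewrite -(expg1 z) -tz eqo tz' expg1.
Qed.

(** Let (x, y) be in H, and let D be the fibre of H over 1.  The fibre over x ^+ i
    is the coset of y ^+ i modulo D, and D, a subgroup of the cyclic group B, is
    the kernel in B of the |D|-th power.  Hence (x ^+ i, t) is in H iff
    t^|D| = (y^|D|)^i, which is the equation of [twisted_kernel] for z = y^|D|
    once #[z] = |B| / |D| is known. *)
Lemma subdirect_twisted_group (gT rT : finGroupType) (x : gT) (B : {group rT})
    (H : {group gT * rT}) :
    cyclic B -> subdirect <[x]> B H ->
  exists2 z, z \in [set z in B | #[z] %| #[x]] & H = twisted_group x B z.
Proof.
move=> cycB /andP[/eqP fstH /eqP sndH].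
have : x \in fst @: H by rewrite fstH cycle_id.
case/imsetP=> [[s y] Hxy /= eqx]; rewrite -{s}eqx in Hxy.
have inB p : p \in H -> p.2 \in B by move=> Hp; rewrite -sndH imset_f.
have By : y \in B := inB _ Hxy.
have Hxyi i : (x ^+ i, y ^+ i) \in H.
  by rewrite -expg_pair groupX.
have D_group : group_set [set t | (1, t) \in H].
  apply/group_setP; split=> [|t u]; rewrite !inE ?group1 // => Ht Hu.
  by have := groupM Ht Hu; rewrite /= -[(1, t) * _]/(1 * 1, t * u) mulg1.
pose D := Group D_group.
have sDB : D \subset B by apply/subsetP=> t; rewrite inE => /inB.
have memD t : (1, t) \in H = (t \in B) && (t ^+ #|D| == 1).
  have -> : ((1, t) \in H) = (t \in D) by rewrite inE.
  have [Bt|nBt] := boolP (t \in B); first by rewrite (mem_sub_cyclic cycB).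
  by rewrite (contraNF (subsetP sDB t)).
have memH i t : (x ^+ i, t) \in H = (t \in B) && (t ^+ #|D| == (y ^+ #|D|) ^+ i).
  have -> : (x ^+ i, t) \in H = ((1, t * y ^- i) \in H).
    rewrite -(groupMr _ (groupVr (Hxyi i))).
    by rewrite -[_ * _]/(x ^+ i * x ^- i, t * y ^- i) mulgV.
  rewrite memD groupMr ?groupV ?groupX //; have [Bt|//] := boolP (t \in B).
  have cty : commute t (y ^- i).
    by apply: (centsP (cyclic_abelian cycB)); rewrite ?groupV ?groupX.
  by rewrite expgMn //= expgVn -eq_mulgV1 -!expgM mulnC.
pose z := y ^+ #|D|.
have Bz : z \in B by rewrite groupX.
have dDB : #|D| %| #|B| := cardSg sDB.
(* Take i = #[x] and t = 1 in memH. *)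
have dvz : #[z] %| #[x].
  have := memH #[x] 1; rewrite expg_order (group1 H) group1 expg1n /= eq_sym => /esym.
  by rewrite eq_sym order_dvdn eq_sym.
(* B is generated by D and y as H projects onto it, so z generates the image of
   the |D|-th power, which has order |B| / |D|. *)
have oz : #[z] = #|B| %/ #|D|.
  have [w defB] := cyclicP cycB.
  have dDw : #|D| %| #[w] by rewrite [#[w]]orderE -defB.
  have Bw : w \in B by rewrite defB cycle_id.
  have -> : #|B| %/ #|D| = #[w ^+ #|D|] by rewrite orderXdiv // orderE -defB.
  suff : <[z]> = <[w ^+ #|D|]> by rewrite !orderE => ->.
  apply/eqP; rewrite eqEsubset !cycle_subG; apply/andP; split.
    rewrite /z; have /cycleP[k ->] : y \in <[w]> by rewrite -defB.
    by rewrite -expgM mulnC expgM mem_cycle.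
  move: Bw; rewrite -{1}sndH => /imsetP[[s t] Hst /= ->].
  have /cycleP[i eqs] : s \in <[x]> by rewrite -fstH (imset_f fst Hst).
  by move: Hst; rewrite eqs memH => /andP[_ /eqP->]; rewrite mem_cycle.
have eqD : #|B| %/ #[z] = #|D| by rewrite oz divnA // mulKn ?cardG_gt0.
exists z; first by rewrite inE Bz.
apply/val_inj; rewrite /= twisted_groupE //; apply/setP=> -[s t].
have [/cycleP[i ->]|ns] := boolP (s \in <[x]>).
  by rewrite memH twisted_kernelE // eqD.
transitivity false.
  by apply: contraNF ns => Hst; rewrite -fstH (imset_f fst Hst).
apply/esym; apply: contraNF ns => /(twisted_kernelP _ _ dvz)[i [u [[-> _] _ _]]].
exact: mem_cycle.
Qed.

Lemma card_subdirect (gT rT : finGroupType) (A : {group gT}) (B : {group rT}) :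
    cyclic A -> cyclic B ->
  #|[set H : {group gT * rT} | subdirect A B H]| = gcdn #|A| #|B|.
Proof.
case/cyclicP=> x -> cycB; rewrite -orderE -card_order_dvd //.
rewrite -(card_in_imset (twisted_group_inj cycB)); apply: eq_card => H.
rewrite inE; apply/idP/imsetP; first exact: subdirect_twisted_group.
by case=> z /setIdP[Bz dvz] ->; apply: twisted_group_subdirect.
Qed.

(** * Subgroups of given exponent *)

Lemma imset_fst (gT rT : finGroupType) (H : {group gT * rT}) : fst @: H = fst @* H.
Proof. by rewrite (morphimEsub (fst_morphism gT rT)) ?subsetT. Qed.

Lemma imset_snd (gT rT : finGroupType) (H : {group gT * rT}) : snd @: H = snd @* H.
Proof. by rewrite (morphimEsub (snd_morphism gT rT)) ?subsetT. Qed.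

(** The orders i and j determine the projections, by uniqueness of the subgroups
    of given order in G and in K. *)
Lemma card_subgroups_proj (gT rT : finGroupType) (G : {group gT}) (K : {group rT})
    (i j : nat) :
    cyclic G -> cyclic K -> i %| #|G| -> j %| #|K| ->
  #|[set H in subgroups (setX G K) | (#|fst @: H| == i) && (#|snd @: H| == j)]|
    = gcdn i j.
Proof.
move=> cycG cycK /(ex_sub_cyclic cycG)[A sAG <-] /(ex_sub_cyclic cycK)[B sBK <-].
rewrite -card_subdirect ?(cyclicS sAG) ?(cyclicS sBK) //.
apply: eq_card => H; rewrite !inE /subdirect !imset_fst !imset_snd.
apply/andP/andP=> [[sH /andP[oA oB]]|[/eqP eqA /eqP eqB]].
  rewrite (eq_subG_cyclic cycG) ?(eq_subG_cyclic cycK) //.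
    by rewrite -(morphim_sndX G K) morphimS.
  by rewrite -(morphim_fstX G K) morphimS.
rewrite eqA eqB !eqxx; split=> //; apply/subsetP=> p Hp; rewrite inE.
rewrite (subsetP sAG) ?(subsetP sBK) // -?eqA -?eqB -?imset_fst -?imset_snd ?imset_f //.
Qed.

Lemma exponent_subgroup_prod (gT rT : finGroupType) (G : {group gT}) (K : {group rT})
    (H : {group gT * rT}) :
    cyclic G -> cyclic K -> H \subset setX G K ->
  exponent H = lcmn #|fst @: H| #|snd @: H|.
Proof.
move=> cycG cycK sH; rewrite !imset_fst !imset_snd.
have sA : fst @* H \subset G by rewrite -(morphim_fstX G K) morphimS.
have sB : snd @* H \subset K by rewrite -(morphim_sndX G K) morphimS.
rewrite -(exponent_cyclic (cyclicS sA cycG)) -(exponent_cyclic (cyclicS sB cycK)).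
apply/eqP; rewrite eqn_dvd dvdn_lcm !exponent_morphim !andbT.
apply/exponentP=> -[s t] Hst.
rewrite expg_pair; congr (_, _); apply/eqP; rewrite -order_dvdn.
  rewrite (dvdn_trans _ (dvdn_lcml _ _)) // dvdn_exponent //.
  exact: (mem_morphim (fst_morphism gT rT) (in_setT _) Hst).
rewrite (dvdn_trans _ (dvdn_lcmr _ _)) // dvdn_exponent //.
exact: (mem_morphim (snd_morphism gT rT) (in_setT _) Hst).
Qed.

(** Double counting: a subgroup H of exponent E is counted on the right only at
    (i, j) = (|fst @: H|, |snd @: H|), where the condition lcm(i, j) = E holds by
    [exponent_subgroup_prod]; a subgroup of another exponent is never counted. *)
Lemma card_subgroups_exponent (gT rT : finGroupType) (G : {group gT})
    (K : {group rT}) (E : nat) :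
    cyclic G -> cyclic K ->
  #|[set H in subgroups (setX G K) | exponent H == E]| =
    (\sum_(i <- divisors #|G|) \sum_(j <- divisors #|K| | lcmn i j == E) gcdn i j)%N.
Proof.
move=> cycG cycK.
have sub_fst (H : {group gT * rT}) : H \subset setX G K -> #|fst @: H| %| #|G|.
  move=> sH; rewrite imset_fst cardSg // -(morphim_fstX G K) morphimS //.
have sub_snd (H : {group gT * rT}) : H \subset setX G K -> #|snd @: H| %| #|K|.
  move=> sH; rewrite imset_snd cardSg // -(morphim_sndX G K) morphimS //.
transitivity (\sum_(i <- divisors #|G|) \sum_(j <- divisors #|K| | lcmn i j == E)
  #|[set H in subgroups (setX G K) | (#|fst @: H| == i) && (#|snd @: H| == j)]|)%N;
  last first.
  rewrite big_seq [RHS]big_seq; apply: eq_bigr => i; rewrite -dvdn_divisors // => di.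
  rewrite big_seq_cond [RHS]big_seq_cond; apply: eq_bigr => j /andP[].
  by rewrite -dvdn_divisors // => dj _; rewrite card_subgroups_proj.
under [RHS]eq_bigr do (under eq_bigr do rewrite -sum1_card big_mkcond /=;
  rewrite exchange_big /=).
rewrite exchange_big /= -sum1_card big_mkcond; apply: eq_bigr => H _ /=.
rewrite !inE; case sH: (H \subset _); last first.
  by rewrite /= big1 // => i _; rewrite big1 // => j _; rewrite !inE sH.
rewrite (exponent_subgroup_prod cycG cycK sH) /=.
have fstm : #|fst @: H| \in divisors #|G| by rewrite -dvdn_divisors // sub_fst.
have sndm : #|snd @: H| \in divisors #|K| by rewrite -dvdn_divisors // sub_snd.
rewrite (bigD1_seq _ fstm (divisors_uniq _)) /= [X in (_ + X)%N]big1 ?addn0; last first.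
  move=> i ni; rewrite big1 // => j _; rewrite !inE sH /=.
  by rewrite eq_sym (negbTE ni).
rewrite big_mkcond (bigD1_seq _ sndm (divisors_uniq _)) /= big1 ?addn0; last first.
  by move=> j nj; rewrite !inE sH /= [_ == j]eq_sym (negbTE nj) andbF if_same.
by rewrite !inE sH !eqxx.
Qed.

Lemma cyclic_Zp (n : nat) : cyclic (Zp n).
Proof.
by rewrite /Zp; case: ifP => _; [rewrite Zp_cycle cycle_cyclic | exact: cyclic1].
Qed.

Import GRing.Theory.
Local Open Scope ring_scope.

Theorem proposition3p1 (m n E : nat) (m_gt0 : (0 < m)%N) (n_gt0 : (0 < n)%N)
    (E_gt0 : (0 < E)%N) (E_dvd : (E %| lcmn m n)%N) :
  num_subgroups_exponent E m n =
    (\sum_(i <- divisors m) \sum_(j <- divisors n | lcmn i j == E) gcdn i j)%N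
  /\
  (\sum_(i <- divisors m) \sum_(j <- divisors n | lcmn i j == E) gcdn i j)%N%:R
    = 1 / E%:R *
      (\sum_(i <- divisors m) \sum_(j <- divisors n | lcmn i j == E) (i * j))%N%:R
    :> rat.
Proof.
split.
  rewrite /num_subgroups_exponent card_subgroups_exponent ?cyclic_Zp //.
  by rewrite !card_Zp.
have -> : (\sum_(i <- divisors m) \sum_(j <- divisors n | lcmn i j == E) (i * j)
    = E * \sum_(i <- divisors m) \sum_(j <- divisors n | lcmn i j == E) gcdn i j)%N.
  rewrite big_distrr /=; apply: eq_bigr => i _.
  rewrite big_distrr /=; apply: eq_bigr => j /eqP <-.
  by rewrite muln_lcm_gcd.
by rewrite natrM mulrA divfK ?mul1r // Num.Theory.pnatr_eq0 -lt0n.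
Qed.
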